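(* For integers $l,k\ge 2$, as $n\to\infty$, $$ex(n,P_l,C_{2k})\le (1+o(1))\frac12 (k-1)^{\frac{l-1}{2}}n^{\frac{l+1}{2}}.$$
   Context: $C_k$ denotes the cycle with $k$ vertices and $P_l$ the path with $l$ vertices. $ex(n,H,F)$ is the maximum number of subgraphs isomorphic to $H$ in an $n$-vertex graph containing no subgraph isomorphic to $F$. *)

(* Defs.v *)
From mathcomp Require Import all_boot all_order all_algebra.
From mathcomp Require Import reals.
Set Implicit Arguments. Unset Strict Implicit. Unset Printing Implicit Defensive.

Definition simple_graph (n : nat) (E : {set 'I_n * 'I_n}) : bool :=
  [forall x, forall y, ((x, y) \in E) == ((y, x) \in E)] &&
  [forall x, (x, x) \notin E].

Definition has_cycle (n m : nat) (E : {set 'I_n * 'I_n}) : bool :=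
  [exists f : {ffun 'I_m -> 'I_n},
     injectiveb f && [forall i : 'I_m, (f i, f (ordS i)) \in E]].

Definition is_path (n l : nat) (E : {set 'I_n * 'I_n}) (f : {ffun 'I_l -> 'I_n}) : bool :=
  injectiveb f &&
  [forall i : 'I_l, forall j : 'I_l, (val j == (val i).+1) ==> ((f i, f j) \in E)].

(* Canonical orientation: first vertex has smaller label than last vertex.
   For l >= 2 each copy of P_l (a subgraph) has exactly one such traversal. *)
Definition oriented (n l : nat) (f : {ffun 'I_l -> 'I_n}) : bool :=
  [forall i : 'I_l, forall j : 'I_l,
     ((val i == 0) && (val j == l.-1)) ==> (val (f i) < val (f j))].

(* Number of subgraphs of E isomorphic to P_l (valid for l >= 2). *)
Definition num_paths (n l : nat) (E : {set 'I_n * 'I_n}) : nat :=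
  #|[set f : {ffun 'I_l -> 'I_n} | is_path E f && oriented f]|.

Definition ex_path_cycle (n l m : nat) : nat :=
  \max_(E : {set 'I_n * 'I_n} | simple_graph E && ~~ has_cycle m E) num_paths l E.

(* Main.v *)
(* Let q = k - 1 and let M x z be the number of paths x - y - z with x <> z.
   For a C_2k-free graph, a path with 2k - 1 vertices avoiding x cannot join two
   neighbours of x.  Peeling off low-degree vertices, and building such a path
   greedily in what is left, bounds the edges between N(x) and the rest by
   q (d x + |rest|) and the edges inside N(x) by O(d x); hence the row of x
   in M sums to at most q n + O(d x).  Paths on l vertices are counted by
   1^T M^m g, with g = 1 when l = 2m + 1 and g = d when l = 2m + 2.  Each factor M
   contributes q n, and the O(d x) errors have lower order, because all rows of
   M are O(n) and the sum of d^2 is O(n^2).  By Cauchy-Schwarz the same row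
   bound gives sum d <= (1 + o(1)) sqrt(q) n^(3/2).  Each subgraph P_l is
   traversed in two directions, whence the factor 1/2. *)
Require Import Defs.
From mathcomp Require Import all_boot all_order all_algebra.
From mathcomp Require Import reals.
From mathcomp Require Import zify ring lra.
Import Order.TTheory GRing.Theory Num.Theory.
Set Implicit Arguments. Unset Strict Implicit. Unset Printing Implicit Defensive.
Local Open Scope ring_scope.

(** * Paths alternating between two vertex sets *)

Section Peeling.
Local Open Scope nat_scope.
Variables (T : finType) (e : rel T).

Definition deg_in (A : {set T}) (x : T) : nat := \sum_(y in A) e x y.

(** This counts ordered pairs: an edge inside the intersection of [A] and [B] counts twice. *)
Definition edges (A B : {set T}) : nat := \sum_(x in A) deg_in B x.

Lemma deg_inE (A : {set T}) (x : T) : deg_in A x = #|[set y in A | e x y]|.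
Proof.
rewrite /deg_in big_mkcond -sum1_card [RHS]big_mkcond /=.
by apply: eq_bigr => y _; rewrite inE; case: (y \in A); case: (e x y).
Qed.

Hypothesis esym : symmetric e.

Lemma edgesC (A B : {set T}) : edges A B = edges B A.
Proof.
rewrite /edges /deg_in exchange_big; apply: eq_bigr => y _.
by apply: eq_bigr => x _; rewrite esym.
Qed.

Lemma edgesD1 (A B : {set T}) (x : T) : x \in A ->
  edges A B = deg_in B x + edges (A :\ x) B.
Proof.
move=> xA; rewrite /edges (bigD1 x) //=; congr (_ + _).
by apply: eq_bigl => y; rewrite !inE andbC.
Qed.

(** Deleting a vertex with at most [t] neighbours on the other side costs at most [t] and lowers
    [#|A| + #|B|] by one. The process can stall only when [A] is empty or at a core, which the
    hypothesis excludes. *)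
Lemma edges_peel (t : nat) (A B : {set T}) :
    (forall A' B' : {set T}, A' \subset A -> B' \subset B -> A' != set0 ->
      {in A', forall x, t < deg_in B' x} ->
      {in B', forall y, t < deg_in A' y} -> False) ->
  edges A B <= t * (#|A| + #|B|).
Proof.
move: {2}(#|A| + #|B|) (leqnn (#|A| + #|B|)) => s.
elim: s A B => [|s IHs] A B leAB nocore.
  have /eqP : #|A| = 0 by lia.
  by rewrite cards_eq0 => /eqP ->; rewrite /edges big_set0.
have [/exists_inP[x xA lex] | /exists_inPn lowA] :=
  boolP [exists x in A, deg_in B x <= t].
  rewrite (edgesD1 _ xA).
  have cA := cardsD1 x A; rewrite xA /= in cA.
  suff : edges (A :\ x) B <= t * (#|A :\ x| + #|B|) by nia.
  apply: IHs => [|A' B' sA sB]; first by lia.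
  by apply: nocore => //; apply: subset_trans sA (subD1set _ _).
have [/exists_inP[y yB ley] | /exists_inPn lowB] :=
  boolP [exists y in B, deg_in A y <= t].
  rewrite edgesC (edgesD1 _ yB) edgesC.
  have cB := cardsD1 y B; rewrite yB /= in cB.
  suff : edges A (B :\ y) <= t * (#|A| + #|B :\ y|) by nia.
  apply: IHs => [|A' B' sA sB]; first by lia.
  by apply: nocore => //; apply: subset_trans sB (subD1set _ _).
have [->|A0] := eqVneq A set0; first by rewrite /edges big_set0.
case: (nocore A B) => // [x xA | y yB]; rewrite ltnNge.
- exact: lowA.
- exact: lowB.
Qed.

(** Only entries of [s] inside [A] can block a neighbour. Counting these rather than all of [s]
    saves a factor 2 when the path alternates between disjoint sets. *)
Lemma fresh_neighbor (A : {set T}) (x : T) (s : seq T) :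
  count (mem A) s < deg_in A x -> uniq s -> exists y, [/\ y \in A, e x y & y \notin s].
Proof.
rewrite deg_inE => lts us.
have [/exists_inP[y] | /exists_inPn noy] :=
  boolP [exists y in [set y in A | e x y], y \notin s].
  by rewrite inE => /andP[yA exy] ys; exists y.
move: lts; rewrite ltnNge => /negP[].
rewrite -size_filter -(card_uniqP (filter_uniq _ us)).
apply/subset_leq_card/subsetP => y yN.
have := noy y yN; rewrite negbK mem_filter => ->; rewrite andbT.
by move: yN; rewrite inE => /andP[].
Qed.

(* [r] records whether [A] and [B] may overlap: then a vertex of the path
   counts as used on both sides. *)
Lemma alternating_path (A B : {set T}) (r : bool) (m : nat) :
    (~~ r -> [disjoint A & B]) -> A != set0 ->
    {in A, forall x, m * r.+1 < deg_in B x} ->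
    {in B, forall y, m * r.+1 < deg_in A y} ->
  exists x s, [/\ x \in A, last x s \in A, uniq (x :: s) & path e x s] /\
    (size s = m.*2 /\ {subset x :: s <= A :|: B}).
Proof.
move=> disj /set0Pn[x0 x0A] degA degB.
(* After [j] rounds, [j.+1] vertices were picked in [A] and [j] in [B]. If [r] holds, each may also
   occupy the other side, whence the summands with factor [r]. *)
suff /(_ m (leqnn m)) : forall j, j <= m -> exists x s,
  [/\ x \in A, last x s \in A, uniq (x :: s) & path e x s] /\
  [/\ size s = j.*2, {subset x :: s <= A :|: B},
      count (mem A) (x :: s) <= j.+1 + r * j &
      count (mem B) (x :: s) <= j + r * j.+1].
  by case=> x [s [[? ? ? ?] [? ? _ _]]]; exists x, s; split.
have AB z : z \in A -> z \in B -> r.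
  move=> zA zB; apply/negPn/negP => /disj /pred0P/(_ z) /=.
  by rewrite zA zB.
have memr z : z \in A -> (z \in B : nat) <= r.
  by move=> zA; case zB: (z \in B) => //; rewrite (AB z).
have memr' z : z \in B -> (z \in A : nat) <= r.
  by move=> zB; case zA: (z \in A) => //; rewrite (AB z).
elim=> [_|j IHj ltjm].
  exists x0, [::]; split=> //; split=> //.
  - by move=> z; rewrite !inE => /eqP ->; rewrite x0A.
  - by rewrite /= x0A.
  - by rewrite /= addn0 muln1 add0n memr.
have {IHj}[x [s [[xA lA us ps] [sz sub cA cB]]]] := IHj (ltnW ltjm).
have [|y [yB ey ys]] := @fresh_neighbor B (last x s) (x :: s) _ us.
  apply: leq_ltn_trans (degA _ lA); move: cB ltjm; clear; case: r => /=; lia.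
have us1 : uniq (y :: x :: s) by rewrite cons_uniq ys us.
(* The tight step: [y] may itself lie in [A], so up to [j.+1 * r.+1 <= m * r.+1] places are
   taken. *)
have [|z [zA ez zs]] := @fresh_neighbor A y (y :: x :: s) _ us1.
  have := memr' y yB; rewrite /= in cA *.
  move=> ry; apply: leq_ltn_trans (degB _ yB).
  by move: cA ry ltjm; clear; case: r => /=; lia.
exists x, (rcons (rcons s y) z); rewrite !last_rcons !size_rcons sz.
have perm1 : perm_eq (x :: rcons (rcons s y) z) (z :: y :: x :: s).
  by rewrite -!rcons_cons !perm_rcons perm_cons perm_rcons.
split; split=> //.
- by rewrite (perm_uniq perm1) cons_uniq zs us1.
- by rewrite !rcons_path ps last_rcons ey.
- move=> w; rewrite (perm_mem perm1) 2!in_cons => /orP[/eqP->|/orP[/eqP->|/sub//]].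
    by rewrite inE zA.
  by rewrite inE yB orbT.
- rewrite (permP perm1) /= zA; have := memr' y yB; rewrite /= in cA.
  by move: cA; clear; case: r => /=; lia.
- rewrite (permP perm1) /= yB; have := memr z zA; rewrite /= in cB.
  by move: cB; clear; case: r => /=; lia.
Qed.

End Peeling.

(** * Paths with three vertices *)

Section TwoPaths.
Local Open Scope nat_scope.
Variables (T : finType) (e : rel T).

Definition nbr (x : T) : {set T} := [set y | e x y].

Definition deg (x : T) : nat := #|nbr x|.

Definition two_paths (x z : T) : nat := \sum_y [&& x != z, e x y & e y z].

Lemma degE (x : T) : deg x = \sum_y e x y.
Proof.
rewrite /deg -sum1_card big_mkcond /=.
by apply: eq_bigr => y _; rewrite inE; case: (e x y).
Qed.

Hypothesis esym : symmetric e.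

Lemma two_pathsC (x z : T) : two_paths x z = two_paths z x.
Proof.
by apply: eq_bigr => y _; rewrite eq_sym (esym x) (esym y z) (andbC (e y x)).

Qed.

(** Both sides count walks x - y - z, grouped by the middle vertex on the left and by the ends on
    the right, where the closed walks give the degrees. *)
Lemma sum_sqr_deg : \sum_x deg x ^ 2 = \sum_x \sum_z two_paths x z + \sum_x deg x.
Proof.
transitivity (\sum_x \sum_z \sum_y (e x y && e y z)).
  transitivity (\sum_y \sum_x \sum_z (e x y && e y z)).
    apply: eq_bigr => y _; rewrite -mulnn degE big_distrl /=.
    apply: eq_bigr => x _; rewrite big_distrr /=.
    by apply: eq_bigr => z _; rewrite (esym x) mulnb.
  by rewrite exchange_big; apply: eq_bigr => x _; rewrite exchange_big.
rewrite -big_split; apply: eq_bigr => x _ /=.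
rewrite (bigD1 x) //= [in RHS](bigD1 x) //= addnAC.
have -> : two_paths x x = 0 by rewrite /two_paths eqxx big1.
congr (_ + _).
  by rewrite degE; apply: eq_bigr => y _; rewrite (esym y) andbb.
by apply: eq_bigr => z zx; rewrite /two_paths eq_sym zx.
Qed.

Variable q : nat.
Hypothesis nocycle : forall c : seq T, size c = q.+1.*2 -> uniq c -> ~~ cycle e c.

(** A core would contain an alternating path on [2 * q + 1] vertices with both ends in [nbr x], and
    [x] closes it into a cycle of the forbidden length. *)
Lemma edges_nbr (x : T) (B : {set T}) (r : bool) :
    x \notin nbr x -> x \notin B -> (~~ r -> [disjoint nbr x & B]) ->
  edges e (nbr x) B <= q * r.+1 * (deg x + #|B|).
Proof.
move=> xN xB disj; apply: edges_peel => // A' B' sA sB A0 degA degB.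
have [|y [s [[yA lA us ps] [sz sub]]]] :=
  @alternating_path _ _ A' B' r q _ A0 degA degB.
  by move=> /disj d; exact: disjointWl sA (disjointWr sB d).
apply: (negP (@nocycle (x :: y :: s) _ _)).
- by rewrite /= sz doubleS.
- rewrite cons_uniq us andbT; apply/negP => /sub; rewrite inE => /orP[].
    by move/(subsetP sA); apply/negP.
  by move/(subsetP sB); apply/negP.
- have := subsetP sA _ yA; have := subsetP sA _ lA; rewrite !inE => xl xy.
  by rewrite /= xy rcons_path ps /= esym.
Qed.

Hypothesis eirr : irreflexive e.

(** Edges from [nbr x] into itself give [2 * q * (2 * deg x)], as the two sides coincide. Edges to
    the vertices outside [x |: nbr x] give at most [q * #|T|]. *)
Lemma two_paths_from_le (x : T) :
  \sum_z two_paths x z <= q * #|T| + 4 * q * deg x.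
Proof.
have xN : x \notin nbr x by rewrite inE eirr.
have -> : \sum_z two_paths x z = edges e (nbr x) (~: [set x]).
  rewrite /edges /deg_in exchange_big [RHS]big_mkcond /=.
  apply: eq_bigr => y _; rewrite inE; case: (e x y); last first.
    by apply: big1 => z _; rewrite andbF.
  rewrite [RHS]big_mkcond; apply: eq_bigr => z _.
  by rewrite !inE eq_sym; case: (z == x).
have -> : edges e (nbr x) (~: [set x]) =
    edges e (nbr x) (nbr x) + edges e (nbr x) (~: (x |: nbr x)).
  rewrite -big_split; apply: eq_bigr => y _ /=.
  rewrite /deg_in (big_setID (nbr x)) /=; congr (_ + _); apply: eq_bigl => z.
    by rewrite !inE; case: eqVneq => // ->; rewrite eirr.
  by rewrite !inE negb_or andbC.
have := @edges_nbr x (nbr x) true xN xN (fun h => False_ind _ (notF h)).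
have xC : x \notin ~: (x |: nbr x) by rewrite !inE eqxx.
have := @edges_nbr x (~: (x |: nbr x)) false xN xC.
have -> : [disjoint nbr x & ~: (x |: nbr x)].
  by rewrite disjoints_subset setCK subsetUr.
move=> /(_ (fun=> isT)).
have cN : deg x + #|~: (x |: nbr x)| <= #|T|.
  rewrite -(cardsC (x |: nbr x)) leq_add2r /deg.
  exact/subset_leq_card/subsetUr.
rewrite -/(deg x); nia.
Qed.

Definition num_ext (l : nat) (x : T) : nat :=
  \sum_(t : l.-tuple T) (path e x t && uniq (x :: t)).

Lemma sum_tupleS (l : nat) (F : l.+1.-tuple T -> nat) :
  \sum_t F t = \sum_x \sum_(t : l.-tuple T) F [tuple of x :: t].
Proof.
rewrite pair_big /= (reindex (fun p : T * l.-tuple T => [tuple of p.1 :: p.2])) //.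
exists (fun t => (thead t, [tuple of behead t])) => [[x t] _ | t _] /=.
  by congr (_, _); apply: val_inj.
by rewrite [RHS]tuple_eta.
Qed.

Lemma num_ext0 (x : T) : num_ext 0 x <= 1.
Proof.
rewrite /num_ext; apply: (@leq_trans (\sum_(t : 0.-tuple T) 1)).
  by apply: leq_sum => t _; exact: leq_b1.
by rewrite sum1_card card_tuple expn0.
Qed.

Lemma num_ext1 (x : T) : num_ext 1 x <= deg x.
Proof.
rewrite /num_ext sum_tupleS degE; apply: leq_sum => y _.
apply: (@leq_trans (\sum_(t : 0.-tuple T) e x y)).
  by apply: leq_sum => t _ /=; case: (e x y); rewrite ?leq_b1.
by rewrite sum_nat_const card_tuple expn0 mul1n.
Qed.

(** The first two steps x - y - z are split off. Clashes of [x] or [y] with vertices after [z] are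
    ignored, hence only an inequality. *)
Lemma num_extSS (l : nat) (x : T) :
  num_ext l.+2 x <= \sum_z two_paths x z * num_ext l z.
Proof.
rewrite /num_ext sum_tupleS.
under eq_bigr do rewrite sum_tupleS.
rewrite exchange_big /=.
apply: leq_sum => z _; rewrite /two_paths big_distrl /=.
apply: leq_sum => y _; rewrite big_distrr /=; apply: leq_sum => t _.
rewrite mulnb /= !in_cons !negb_or.
case: (e x y) => //; case: (e y z) => //=; case: (x != z); rewrite ?andbF //=.
case: (path e z t) => //=; case: (z \notin t); rewrite ?andbF //=.
by case: (uniq t); rewrite ?andbF //= leq_b1.
Qed.

End TwoPaths.

(** * Iterating the kernel of two-step moves *)

Section Kernel.
Local Open Scope nat_scope.
Variables (T : finType) (M : T -> T -> nat).

Definition act (v : T -> nat) (x : T) : nat := \sum_z M x z * v z.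

Lemma actE (v : T -> nat) (x : T) : act v x = \sum_z M x z * v z.
Proof. by []. Qed.

Lemma act_le (v w : T -> nat) :
  (forall x, v x <= w x) -> forall x, act v x <= act w x.
Proof. by move=> vw x; apply: leq_sum => z _; rewrite leq_mul2l vw orbT. Qed.

Lemma iter_act_le (m : nat) (v w : T -> nat) :
  (forall x, v x <= w x) -> forall x, iter m act v x <= iter m act w x.
Proof. by move=> vw; elim: m => //= m IHm; exact: act_le. Qed.

(** The inequality [2 * (c * v z) <= c ^ 2 + v z ^ 2] at the far end propagates through the
    nonnegative entries of [M]. *)
Lemma iter_act_AMGM (m c : nat) (v : T -> nat) (x : T) :
  2 * (c * iter m act v x) <=
  c ^ 2 * iter m act (fun=> 1) x + iter m act (fun z => v z ^ 2) x.
Proof.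
elim: m x => [|m IHm] x /=; first by rewrite muln1 nat_Cauchy.
rewrite !actE !big_distrr -big_split /=; apply: leq_sum => z _.
have := leq_mul (leqnn (M x z)) (IHm z); lia.
Qed.

Hypothesis Msym : forall x z, M x z = M z x.

Lemma sum_mul_act (h v : T -> nat) :
  \sum_x h x * act v x = \sum_x act h x * v x.
Proof.
under eq_bigr do rewrite big_distrr /=.
rewrite exchange_big; apply: eq_bigr => z _; rewrite big_distrl /=.
by apply: eq_bigr => x _; rewrite Msym; lia.
Qed.

(** By symmetry column sums are row sums, so row bounds control the total mass. *)
Lemma sum_act (v : T -> nat) : \sum_x act v x = \sum_x (\sum_z M x z) * v x.
Proof.
transitivity (\sum_x 1 * act v x); first by apply: eq_bigr => x _; rewrite mul1n.
rewrite sum_mul_act; apply: eq_bigr => x _; congr (_ * _).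
by apply: eq_bigr => z _; rewrite muln1.
Qed.

Section RowBound.
Variable K : nat.
Hypothesis rowM : forall x, \sum_z M x z <= K.

Lemma iter_act1_le (m : nat) (x : T) : iter m act (fun=> 1) x <= K ^ m.
Proof.
elim: m x => //= m IHm x; apply: (@leq_trans (\sum_z M x z * K ^ m)).
  by apply: leq_sum => z _; rewrite leq_mul2l IHm orbT.
by rewrite -big_distrl expnS leq_mul2r rowM orbT.
Qed.

Lemma sum_iter_act_le (m : nat) (v : T -> nat) :
  \sum_x iter m act v x <= K ^ m * \sum_x v x.
Proof.
elim: m => [|m IHm] /=; first by rewrite mul1n.
rewrite sum_act expnS -mulnA.
apply: leq_trans (leq_mul (leqnn K) IHm).
by rewrite big_distrr; apply: leq_sum => x _; rewrite leq_mul2r rowM orbT.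
Qed.

Lemma sum_mul_iter_act1_le (m : nat) (v : T -> nat) :
  \sum_x v x * iter m act (fun=> 1) x <= K ^ m * \sum_x v x.
Proof.
rewrite big_distrr; apply: leq_sum => x _ /=.
by rewrite mulnC leq_mul2r iter_act1_le orbT.
Qed.

(** AM-GM with [c := v x] bounds twice this quadratic form by two sums, each at most [K ^ m] times
    the sum of squares: Schur's test for a symmetric kernel. *)
Lemma sum_mul_iter_act_le (m : nat) (v : T -> nat) :
  \sum_x v x * iter m act v x <= K ^ m * \sum_x v x ^ 2.
Proof.
rewrite -(leq_pmul2l (isT : 0 < 2)) big_distrr /=.
apply: leq_trans (leq_sum _ (fun x _ => iter_act_AMGM m (v x) v x)) _.
rewrite big_split /=.
have := sum_mul_iter_act1_le m (fun x => v x ^ 2).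
have := sum_iter_act_le m (fun x => v x ^ 2); lia.
Qed.

End RowBound.

(* The rows of [M] sum to [L] up to an error [C * d x], which contributes only
   lower order terms to the total mass of the iterates. *)
Lemma sum_iter_act_main (K L C Z : nat) (d g : T -> nat) (m : nat) :
    L <= K -> (forall x, \sum_z M x z <= L + C * d x) ->
    (forall j, \sum_x d x * iter j act g x <= K ^ j * Z) ->
  \sum_x iter m act g x <= L ^ m * \sum_x g x + m * C * K ^ m.-1 * Z.
Proof.
move=> LK rows cross; elim: m => [|m IHm] /=; first by rewrite mul1n leq_addr.
rewrite sum_act.
apply: (@leq_trans (L * \sum_x iter m act g x + C * (K ^ m * Z))).
  apply: leq_trans (leq_add (leqnn _) (leq_mul (leqnn C) (cross m))).
  rewrite !big_distrr -big_split /=; apply: leq_sum => x _.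
  by have := rows x; nia.
(* At [m = 0] the truncated [m.-1] is harmless, because the factor [m] vanishes. *)
have mK : L * (m * K ^ m.-1) <= m * K ^ m.
  case: m {IHm} => [|m]; first by rewrite !mul0n muln0.
  by rewrite /= [K ^ m.+1]expnS mulnCA leq_mul2l leq_mul2r LK orbT.
rewrite expnS; have := leq_mul (leqnn L) IHm.
have := leq_mul mK (leqnn (C * Z)); nia.
Qed.

End Kernel.

Section PathCount.
Local Open Scope nat_scope.
Variables (T : finType) (e : rel T) (q : nat).
Hypothesis esym : symmetric e.
Hypothesis eirr : irreflexive e.
Hypothesis nocycle : forall c : seq T, size c = q.+1.*2 -> uniq c -> ~~ cycle e c.

Let n := #|T|.
Let D := \sum_x deg e x.

(** A crude row bound from [deg e x <= n]; as the [K] of the iteration it enters error terms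
    only. *)
Lemma two_paths_from_le_card (x : T) : \sum_z two_paths e x z <= 5 * q * n.
Proof.
have := two_paths_from_le esym nocycle eirr x.
by have := max_card (mem (nbr e x)); rewrite -/(deg e x) -/n; nia.
Qed.

Lemma sum_sqr_deg_le : \sum_x deg e x ^ 2 <= q * n ^ 2 + (4 * q).+1 * D.
Proof.
rewrite sum_sqr_deg //.
have : \sum_x \sum_z two_paths e x z <= \sum_(x : T) (q * n + 4 * q * deg e x).
  by apply: leq_sum => x _; exact: two_paths_from_le.
by rewrite big_split sum_nat_const -big_distrr /= -/n -/D; nia.
Qed.

(** Cauchy-Schwarz, by summing [2ab <= a^2 + b^2] over all ordered pairs of vertices. *)
Lemma sqr_sum_deg_le : D ^ 2 <= n * \sum_x deg e x ^ 2.
Proof.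
rewrite -(leq_pmul2l (isT : 0 < 2)).
apply: (@leq_trans (\sum_x \sum_y (deg e x ^ 2 + deg e y ^ 2))).
  rewrite -mulnn big_distrl big_distrr /=; apply: leq_sum => x _.
  by rewrite !big_distrr /=; apply: leq_sum => y _; exact: nat_Cauchy.
under eq_bigr do rewrite big_split sum_nat_const /=.
by rewrite big_split sum_nat_const -big_distrr /= -/n; lia.
Qed.

Lemma num_ext_le_iter (l m : nat) (x : T) :
  num_ext e (l + m.*2) x <= iter m (act (two_paths e)) (num_ext e l) x.
Proof.
elim: m x => [|m IHm] x; first by rewrite addn0.
rewrite doubleS !addnS; apply: leq_trans (num_extSS _ _ _) _.
exact: act_le.
Qed.

Lemma num_paths_odd_le (m : nat) :
  \sum_x num_ext e m.*2 x <=
  (q * n) ^ m * n + m * (4 * q) * (5 * q * n) ^ m.-1 * D.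
Proof.
apply: (@leq_trans (\sum_x iter m (act (two_paths e)) (fun=> 1) x)).
  apply: leq_sum => x _; apply: leq_trans (num_ext_le_iter 0 m x) _.
  by apply: iter_act_le => y; exact: num_ext0.
have sumT : \sum_(x : T) 1 = n by rewrite sum1_card.
rewrite -[X in _ <= _ * X + _]sumT.
apply: sum_iter_act_main => [|||j].
- exact: two_pathsC.
- by nia.
- by move=> x; exact: two_paths_from_le.
- by apply: sum_mul_iter_act1_le; exact: two_paths_from_le_card.
Qed.

(** Iteration starts from the degrees, so the cross terms are quadratic forms in [deg e] and the
    error carries the sum of squared degrees. *)
Lemma num_paths_even_le (m : nat) :
  \sum_x num_ext e m.*2.+1 x <=
  (q * n) ^ m * D +
  m * (4 * q) * (5 * q * n) ^ m.-1 * \sum_x deg e x ^ 2.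
Proof.
apply: (@leq_trans (\sum_x iter m (act (two_paths e)) (deg e) x)).
  apply: leq_sum => x _; apply: leq_trans (num_ext_le_iter 1 m x) _.
  by apply: iter_act_le => y; exact: num_ext1.
apply: sum_iter_act_main => [|||j].
- exact: two_pathsC.
- by nia.
- by move=> x; exact: two_paths_from_le.
- apply: sum_mul_iter_act_le; last exact: two_paths_from_le_card.
  exact: two_pathsC.
Qed.

End PathCount.

(** * Paths and cycles as finite functions *)

Section Encoding.
Local Open Scope nat_scope.
Variables (n : nat) (E : {set 'I_n * 'I_n}).

Definition adj : rel 'I_n := fun x y => (x, y) \in E.

Lemma has_cycleN (m : nat) : 0 < m -> ~~ has_cycle m E ->
  forall c : seq 'I_n, size c = m -> uniq c -> ~~ cycle adj c.
Proof.
move=> m0 noc [|x p] sz uc; first by move: m0; rewrite -sz.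
apply: contra noc => /(pathP x); rewrite size_rcons => cyc.
apply/existsP; exists [ffun i : 'I_m => nth x (x :: p) i].
apply/andP; split.
  apply/injectiveP => i j; rewrite !ffunE => /eqP.
  by rewrite nth_uniq ?sz // => /eqP/val_inj.
apply/forallP => i; rewrite !ffunE /=.
have ltip : i < (size p).+1 by rewrite -/(size (x :: p)) sz.
have := cyc i ltip; rewrite /adj -rcons_cons nth_rcons /= ltip nth_rcons.
move: (nat_of_ord i) ltip => j ltj; rewrite -sz /=.
(* At the last index [ordS] wraps to 0, matching the head that [cycle] appends. *)
have [ltj'|gtj'|->] := ltngtP j (size p).
- by rewrite modn_small.
- by move: ltj; rewrite ltnS leqNgt gtj'.
- by rewrite modnn.
Qed.

Hypothesis symE : forall x y, ((x, y) \in E) = ((y, x) \in E).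

Definition rev_ffun (l : nat) (f : {ffun 'I_l -> 'I_n}) : {ffun 'I_l -> 'I_n} :=
  [ffun i => f (rev_ord i)].

Lemma rev_ffunK (l : nat) : involutive (@rev_ffun l).
Proof. by move=> f; apply/ffunP => i; rewrite !ffunE rev_ordK. Qed.

Lemma is_path_rev (l : nat) (f : {ffun 'I_l -> 'I_n}) :
  is_path E f -> is_path E (rev_ffun f).
Proof.
case/andP=> /injectiveP injf /forallP adjf; apply/andP; split.
  by apply/injectiveP => i j; rewrite !ffunE => /injf /rev_ord_inj.
apply/forallP => i; apply/forallP => j; apply/implyP => /eqP ij.
have /forallP/(_ (rev_ord i))/implyP := adjf (rev_ord j).
rewrite !ffunE symE; apply; rewrite /=; have := ltn_ord j; have := ltn_ord i.
by move: ij; rewrite /=; lia.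
Qed.

Lemma oriented_rev (l : nat) (f : {ffun 'I_l.+2 -> 'I_n}) :
  oriented f -> ~~ oriented (rev_ffun f).
Proof.
move=> /forallP/(_ ord0)/forallP/(_ ord_max)/implyP/(_ (eqxx _)) lt1.
apply/negP => /forallP/(_ ord0)/forallP/(_ ord_max)/implyP/(_ (eqxx _)).
rewrite !ffunE; have -> : rev_ord ord0 = ord_max :> 'I_l.+2.
  by apply: val_inj; rewrite /= subn1.
have -> : rev_ord ord_max = ord0 :> 'I_l.+2 by apply: val_inj; rewrite /= subnn.
by rewrite ltnNge (ltnW lt1).
Qed.

(** Reversal sends oriented traversals injectively to non-oriented ones, so two disjoint families of
    equal size fit among all traversals. *)
Lemma num_paths_double (l : nat) :
  2 * num_paths l.+2 E <= #|[set f : {ffun 'I_l.+2 -> 'I_n} | is_path E f]|.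
Proof.
rewrite /num_paths; set A := [set f | _ && _].
rewrite mul2n -addnn -{2}(card_imset (mem A) (can_inj (@rev_ffunK l.+2))).
have dis : A :&: (@rev_ffun l.+2 @: A) = set0.
  apply/setP => f; rewrite !inE; apply/negP => /andP[/andP[_ of_]].
  case/imsetP => g; rewrite inE => /andP[_ og] fg.
  by move: of_; rewrite fg; apply/negP; exact: oriented_rev.
rewrite -cardsUI dis cards0 addn0; apply/subset_leq_card/subsetP => f.
rewrite !inE => /orP[/andP[]// | /imsetP[g]].
by rewrite inE => /andP[pg _] ->; exact: is_path_rev.
Qed.

Lemma card_is_path_le (l : nat) :
  #|[set f : {ffun 'I_l.+1 -> 'I_n} | is_path E f]| <= \sum_x num_ext adj l x.
Proof.
set A := [set f | _].
pose g (f : {ffun 'I_l.+1 -> 'I_n}) := [tuple f i | i < l.+1].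
have injg : injective g.
  move=> f1 f2 eqf; apply/ffunP => i.
  by have := congr1 (fun t => tnth t i) eqf; rewrite !tnth_mktuple.
rewrite -(card_imset (mem A) injg).
pose B := [set t : l.+1.-tuple 'I_n | sorted adj t && uniq t].
apply: (@leq_trans #|B|).
  apply/subset_leq_card/subsetP => t /imsetP[f]; rewrite !inE.
  case/andP=> /injectiveP injf /forallP adjf ->.
  rewrite map_inj_uniq ?enum_uniq // andbT.
  apply/(sortedP (f ord0)) => i; rewrite size_tuple => lti.
  have nthE j (ltj : j < l.+1) : nth (f ord0) (g f) j = f (Ordinal ltj).
    by rewrite -(tnth_mktuple f (Ordinal ltj)) (tnth_nth (f ord0)).
  rewrite (nthE _ lti) (nthE _ (ltnW lti)).
  by have /forallP/(_ (Ordinal lti))/implyP := adjf (Ordinal (ltnW lti)); apply.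
rewrite -sum1_card big_mkcond sum_tupleS /=; apply: leq_sum => x _.
by rewrite /num_ext; apply: leq_sum => t _; rewrite !inE; case: (_ && _).
Qed.

End Encoding.

(** * Asymptotics *)

Section Asymptotics.
Variable R : realType.

Lemma deg_sum_real_le (n q D Q : nat) : (D ^ 2 <= n * Q)%N ->
    (Q <= q * n ^ 2 + (4 * q).+1 * D)%N ->
  D%:R <= Num.sqrt q%:R * Num.sqrt n%:R ^+ 3 + (4 * q).+1%:R * Num.sqrt n%:R ^+ 2 :> R.
Proof.
move=> DQ QD; set p : R := Num.sqrt q%:R; set s : R := Num.sqrt n%:R.
have p0 : 0 <= p by apply: sqrtr_ge0.
have s0 : 0 <= s by apply: sqrtr_ge0.
have p2 : p ^+ 2 = q%:R by rewrite sqr_sqrtr.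
have s2 : s ^+ 2 = n%:R by rewrite sqr_sqrtr.
set C : R := _.+1%:R.
have C0 : 0 <= C by apply: ler0n.
have : (D ^ 2 <= n * (q * n ^ 2 + (4 * q).+1 * D))%N.
  by apply: leq_trans DQ _; rewrite leq_mul2l QD orbT.
rewrite -(ler_nat R) !(natrM, natrD, natrX) -/C -p2 -s2.
set d : R := D%:R => le2; have d0 : 0 <= d by apply: ler0n.
(* With [u] and [w] the two summands of the bound, the hypotheses give [d ^+ 2 <= u ^+ 2 + w * d],
   whereas [d > u + w] forces [d * (d - w) > u ^+ 2]. *)
rewrite leNgt; apply/negP => lt.
have h1 : 0 <= p * s ^+ 3 by rewrite mulr_ge0 ?exprn_ge0.
have h2 : 0 <= C * s ^+ 2 by rewrite mulr_ge0 ?exprn_ge0.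
set u := p * s ^+ 3 in lt h1 *; set w := C * s ^+ 2 in lt h2 *.
have {le2} : d ^+ 2 <= u ^+ 2 + w * d.
  by apply: (le_trans le2); rewrite le_eqVlt /u /w; apply/orP; left; apply/eqP; ring.
nra.
Qed.

(** Powers of [Num.sqrt n%:R] treat both parities of [l] alike. The error is one power lower, and
    [c] depends on [l] and [q] only. *)
Lemma num_paths_asymptotic (l q : nat) : exists c : R,
  forall (n : nat) (E : {set 'I_n * 'I_n}), (0 < n)%N -> simple_graph E ->
    ~~ has_cycle (2 * q.+1) E ->
  2 * (num_paths l.+2 E)%:R <=
    Num.sqrt q%:R ^+ l.+1 * Num.sqrt n%:R ^+ l.+3 + c * Num.sqrt n%:R ^+ l.+2.
Proof.
set p : R := Num.sqrt q%:R; pose C : R := (4 * q).+1%:R.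
have p0 : 0 <= p by apply: sqrtr_ge0.
have p2 : p ^+ 2 = q%:R by rewrite sqr_sqrtr.
have C0 : 0 <= C by apply: ler0n.
move mE: (l.+1./2) => m; pose a : R := (m * (4 * q) * (5 * q) ^ m.-1)%:R.
have a0 : 0 <= a by apply: ler0n.
(* The first summand comes from the lower-order term of the degree sum. The last bracket, named [B]
   below, bounds both [D / s ^+ 3] and [Q / s ^+ 4]. *)
exists (q%:R ^+ m * C + a * (q%:R + (1 + C) * (p + C))).
move=> n E n0 /andP[/forallP symE /forallP irrE] nocycE.
set s : R := Num.sqrt n%:R.
have s0 : 0 <= s by apply: sqrtr_ge0.
have s2 : s ^+ 2 = n%:R by rewrite sqr_sqrtr.
have s1 : 1 <= s by rewrite -sqrtr1 ler_sqrt ?ltr0n // ler1n.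
have symE' x y : ((x, y) \in E) = ((y, x) \in E).
  by apply/eqP; have /forallP := symE x; apply.
have esym : symmetric (adj E) by move=> x y; exact: symE'.
have eirr : irreflexive (adj E) by move=> x; exact/negbTE/irrE.
have nocyc (c : seq 'I_n) : size c = q.+1.*2 -> uniq c -> ~~ cycle (adj E) c.
  by rewrite -mul2n; apply: has_cycleN.
have := leq_trans (num_paths_double symE' l) (card_is_path_le _ _).
set P := (2 * _)%N => leP; rewrite -(natrM _ 2) -/P.
pose D := (\sum_x deg (adj E) x)%N; pose Q := (\sum_x deg (adj E) x ^ 2)%N.
have leQ := sum_sqr_deg_le esym eirr nocyc; rewrite card_ord -/D -/Q in leQ.
have leD := sqr_sum_deg_le (adj E); rewrite card_ord -/D -/Q in leD.
have {leD} := deg_sum_real_le leD leQ; rewrite -/p -/s -/C => leD.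
have s23 : s ^+ 2 <= s ^+ 3 by rewrite ler_weXn2l.
have s34 : s ^+ 3 <= s ^+ 4 by rewrite ler_weXn2l.
have {}leQ : Q%:R <= (q%:R + C * (p + C)) * s ^+ 4 :> R.
  move: leQ; rewrite -(ler_nat R) !(natrM, natrD, natrX) -/C -s2 => leQ.
  have h1 : D%:R <= (p + C) * s ^+ 3.
    by rewrite mulrDl (le_trans leD) // lerD2l ler_wpM2l.
  have h2 := ler_wpM2l C0 (le_trans h1 (ler_wpM2l (addr_ge0 p0 C0) s34)).
  by apply: (le_trans leQ); rewrite -exprM mulrDl lerD2l -mulrA.
pose B : R := q%:R + (1 + C) * (p + C).
have B0 : 0 <= B by rewrite addr_ge0 // mulr_ge0 ?addr_ge0.
have leD3 : D%:R <= B * s ^+ 3.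
  have h : (p + C) * s ^+ 3 <= B * s ^+ 3.
    rewrite ler_wpM2r ?exprn_ge0 // /B mulrDl mul1r.
    have : 0 <= C * (p + C) by rewrite mulr_ge0 ?addr_ge0.
    by have := ler0n R q; lra.
  by apply: le_trans h; rewrite mulrDl (le_trans leD) // lerD2l ler_wpM2l.
have leQ4 : Q%:R <= B * s ^+ 4.
  apply: (le_trans leQ); rewrite ler_wpM2r ?exprn_ge0 // /B.
  by have := addr_ge0 p0 C0; lra.
(* Both uses reach the exponent [l.+2]: [r = 3] when [l.+1 = m.*2], and [r = 4] when [l = m.*2]. *)
have error_term (r Z : nat) : (0 < m)%N -> Z%:R <= B * s ^+ r ->
    (m * (4 * q) * (5 * q * n) ^ m.-1 * Z)%:R <= a * B * s ^+ (m.-1.*2 + r).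
  move=> m0 leZ.
  have -> : (m * (4 * q) * (5 * q * n) ^ m.-1 * Z)%:R =
      a * (s ^+ m.-1.*2 * Z%:R) :> R.
    by rewrite /a expnMn !(natrM, natrX) -s2 -exprM mul2n; ring.
  by rewrite -mulrA ler_wpM2l // exprD mulrCA ler_wpM2l ?exprn_ge0.
have sl0 : 0 <= s ^+ l.+2 by rewrite exprn_ge0.
have [oddl | evenl] := boolP (odd l).
  have lE : l.+1 = m.*2 by rewrite -mE -[LHS]odd_double_half /= oddl.
  have m0 : (0 < m)%N by rewrite -double_gt0 -lE.
  have := num_paths_odd_le esym eirr nocyc m.
  rewrite card_ord -lE -/D => /(leq_trans leP).
  rewrite -(ler_nat R) natrD => /le_trans; apply.
  have -> : ((q * n) ^ m * n)%:R = p ^+ l.+1 * s ^+ l.+3 :> R.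
    rewrite lE !exprS -mul2n !exprM p2 s2 !(natrM, natrX) exprMn -s2.
    by ring.
  rewrite lerD2l (le_trans (error_term 3 _ m0 leD3)) //.
  have -> : (m.-1.*2 + 3 = l.+2)%N by move: lE m0; clear; lia.
  by rewrite ler_wpM2r // lerDr mulr_ge0 ?exprn_ge0.
have lE : l = m.*2.
  by rewrite -mE -uphalfE uphalf_half (negbTE evenl) even_halfK.
have := num_paths_even_le esym eirr nocyc m.
rewrite card_ord -lE -/D -/Q => /(leq_trans leP).
rewrite -(ler_nat R) natrD => /le_trans; apply.
rewrite mulrDl addrA; apply: lerD.
  have -> : ((q * n) ^ m * D)%:R = q%:R ^+ m * s ^+ l * D%:R :> R.
    by rewrite lE -mul2n exprM s2 !(natrM, natrX) exprMn.
  have -> : p ^+ l.+1 = q%:R ^+ m * p by rewrite exprSr lE -mul2n exprM p2.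
  have c0 : 0 <= q%:R ^+ m * s ^+ l :> R by rewrite mulr_ge0 ?exprn_ge0.
  apply: (le_trans (ler_wpM2l c0 leD)); rewrite le_eqVlt; apply/orP; left; apply/eqP.
  by rewrite -[l.+3]addn3 -[l.+2]addn2 !exprD; ring.
(* For [m = 0] the path is a single edge and the error vanishes; the exponent [m.-1.*2 + 4] would
   exceed [l.+2]. *)
have [m0 | m0] := posnP m.
  by rewrite m0 !mul0n mulr_ge0 // mulr_ge0 // addr_ge0.
rewrite (le_trans (error_term 4 _ m0 leQ4)) //.
by have -> : (m.-1.*2 + 4 = l.+2)%N by move: lE m0; clear; lia.
Qed.

End Asymptotics.

Theorem theorem17 (R : realType) (l k : nat) :
  (2 <= l)%N -> (2 <= k)%N ->
  forall eps : R, 0 < eps ->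
  exists N : nat, forall n : nat, (N <= n)%N ->
    (ex_path_cycle n l (2 * k))%:R <=
      (1 + eps) * 2^-1 * Num.sqrt ((((k - 1) ^ (l - 1)) * n ^ (l + 1))%N%:R).
Proof.
case: l => [|[|l]] // _; case: k => [|q] //; rewrite ltnS => q0 eps eps0.
have [c le_c] := @num_paths_asymptotic R l q.
(* Beyond this bound [c <= eps * s], so the error is at most [eps * s ^+ l.+3]; since [k >= 2] gives
   [p >= 1], this is at most [eps] times the main term. *)
exists (Num.bound ((c / eps) ^+ 2)) => n len.
rewrite !subn1 /= addn1.
set p : R := Num.sqrt q%:R; set s : R := Num.sqrt n%:R.
have p1 : 1 <= p by rewrite -sqrtr1 ler_sqrt ?ltr0n // ler1n.
have s0 : 0 <= s by apply: sqrtr_ge0.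
have bnd : (c / eps) ^+ 2 < n%:R.
  apply: (@lt_le_trans _ _ (Num.bound ((c / eps) ^+ 2))%:R).
    by apply: archi_boundP; exact: sqr_ge0.
  by rewrite ler_nat.
have n0 : (0 < n)%N by rewrite -(ltr0n R) (le_lt_trans (sqr_ge0 _) bnd).
have cs : c <= eps * s.
  rewrite mulrC -ler_pdivrMr // (le_trans (ler_norm _)) // -sqrtr_sqr.
  by rewrite ler_sqrt ?ltr0n // ltW.
have ps0 : 0 <= p ^+ l.+1 * s ^+ l.+3 by rewrite mulr_ge0 ?exprn_ge0 ?sqrtr_ge0.
have -> : Num.sqrt ((q ^ l.+1 * n ^ l.+3)%N%:R) = p ^+ l.+1 * s ^+ l.+3 :> R.
  rewrite -[RHS](ger0_norm ps0) -sqrtr_sqr.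
  by rewrite exprMn -!exprM !(mulnC _ 2) !exprM !sqr_sqrtr // natrM !natrX.
have pl1 : 1 <= p ^+ l.+1 by rewrite exprn_ege1.
have sl0 : 0 <= s ^+ l.+2 by rewrite exprn_ge0.
rewrite /ex_path_cycle; apply: (big_ind (fun x : nat => x%:R <= _)).
- by rewrite mulr_ge0 // divr_ge0 // addr_ge0 // ltW.
- by move=> x y lex ley; rewrite /maxn; case: ifP.
- move=> E /andP[simE nocE]; have := le_c n E n0 simE nocE; rewrite -/p -/s => le2.
  have : c * s ^+ l.+2 <= eps * (p ^+ l.+1 * s ^+ l.+3).
    apply: (le_trans (ler_wpM2r sl0 cs)); rewrite -mulrA -exprS.
    by rewrite ler_wpM2l ?(ltW eps0) // ler_peMl // exprn_ge0.
  lra.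
Qed.
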